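(* Let $f:\{0,1\}^N\rightarrow\{0,1\}$ be a non-constant symmetric Boolean function, write $f_k$ for the value of $f$ on inputs of Hamming weight $k$, and let \[ \Gamma(f)=\min\{|2k-N+1| : f_k\neq f_{k+1},\ 0\le k\le N-1\}. \] Then \[ \mathsf{PostR}_{1/3}(f)\geq \frac{1}{8}\left(N-\Gamma(f)\right). \]
   Context: A Boolean function is symmetric if it is invariant under permutations of its input bits (equivalently, depends only on the Hamming weight). $\mathsf{PostR}_\epsilon(f)$ is the minimum query complexity (maximum depth of a tree in the support) of a probability distribution $\mathcal{A}$ over deterministic decision trees with leaves labelled $0$, $1$ or $\perp$, chosen independently of the input, such that for every input $x$, $\Pr[\mathcal{A}(x)\neq\perp]>0$ and $\Pr[\mathcal{A}(x)=f(x)\mid\mathcal{A}(x)\neq\perp]\ge1-\epsilon$. *)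

(* Defs.v *)
From HB Require Import structures.
From mathcomp Require Import all_boot all_order all_fingroup all_algebra finmap.
From mathcomp Require Import boolp reals interval_inference.
Set Implicit Arguments.
Unset Strict Implicit.
Unset Printing Implicit Defensive.
Import Order.TTheory GRing.Theory Num.Theory.
Local Open Scope ring_scope.

Notation input N := {ffun 'I_N -> bool}.

Definition symmetric_fun (N : nat) (f : input N -> bool) : Prop :=
  forall (s : 'S_N) (x : input N), f [ffun i => x (s i)] = f x.

Definition nonconstant (N : nat) (f : input N -> bool) : Prop :=
  exists x y : input N, f x <> f y.

(* The value f_k of a symmetric f on the inputs of Hamming weight k <= N,
   read off on the representative 1^k 0^(N-k). *)
Definition weight_value (N : nat) (f : input N -> bool) (k : nat) : bool :=
  f [ffun i : 'I_N => (i < k)%N].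

(* The default N of the iterated minimum exceeds every term, since
   |2k - N + 1| <= N - 1 for k < N; it is thus the value only when no k
   satisfies f_k <> f_(k+1), which for a symmetric f means f is constant. *)
Definition Gamma (N : nat) (f : input N -> bool) : nat :=
  \big[minn/N]_(k < N | weight_value f k != weight_value f k.+1)
     absz (2 * k%:Z - N%:Z + 1).

(* [None] is the leaf label \bot; [Query i t0 t1] goes to t0 if x_i = 0 and to
   t1 if x_i = 1.  A variable may be queried several times on a path. *)
Inductive dtree (N : nat) : Type :=
| Leaf of option bool
| Query of 'I_N & dtree N & dtree N.
Arguments Leaf {N} _.

Fixpoint dtree_eval (N : nat) (t : dtree N) (x : input N) : option bool :=
  match t with
  | Leaf o => o
  | Query i t0 t1 => if x i then dtree_eval t1 x else dtree_eval t0 x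
  end.

Fixpoint dtree_depth (N : nat) (t : dtree N) : nat :=
  match t with
  | Leaf _ => 0%N
  | Query _ t0 t1 => (maxn (dtree_depth t0) (dtree_depth t1)).+1
  end.

Fixpoint dtree_encode (N : nat) (t : dtree N) :
    GenTree.tree (option bool + 'I_N) :=
  match t with
  | Leaf o => GenTree.Leaf (inl o)
  | Query i t0 t1 =>
      GenTree.Node 0
        [:: GenTree.Leaf (inr i); dtree_encode t0; dtree_encode t1]
  end.

Fixpoint dtree_decode (N : nat) (t : GenTree.tree (option bool + 'I_N)) :
    option (dtree N) :=
  match t with
  | GenTree.Leaf (inl o) => Some (Leaf o)
  | GenTree.Node _ [:: GenTree.Leaf (inr i); u0; u1] =>
      match dtree_decode u0, dtree_decode u1 with
      | Some t0, Some t1 => Some (Query i t0 t1)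
      | _, _ => None
      end
  | _ => None
  end.

Lemma dtree_encodeK (N : nat) :
  pcancel (@dtree_encode N) (@dtree_decode N).
Proof. by elim=> [o|i t0 IH0 t1 IH1] //=; rewrite IH0 IH1. Qed.

HB.instance Definition _ (N : nat) :=
  Countable.copy (dtree N) (pcan_type (@dtree_encodeK N)).

(* Finitely supported probability distributions.  For decision trees this is
   no restriction: only finitely many trees over N variables have depth at most
   a given d, so every distribution whose support has a maximum depth is
   finitely supported. *)
Record distr (R : realType) (T : choiceType) := Distr {
  pmf :> {fsfun T -> R with 0};
  pmf_ge0 : forall t, 0 <= pmf t;
  pmf_sum1 : \sum_(t <- finsupp pmf) pmf t = 1
}.

Definition Pr (R : realType) (T : choiceType) (A : distr R T) (E : pred T) : R :=
  \sum_(t <- finsupp A | E t) A t.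

Definition condPr (R : realType) (T : choiceType) (A : distr R T)
    (E F : pred T) : R :=
  Pr A [pred t | E t && F t] / Pr A F.

Definition distr_depth (R : realType) (N : nat) (A : distr R (dtree N)) : nat :=
  \max_(t <- finsupp A) dtree_depth t.

Definition postselect_computes (R : realType) (N : nat) (eps : R)
    (f : input N -> bool) (A : distr R (dtree N)) : Prop :=
  forall x : input N,
    let out (t : dtree N) := dtree_eval t x in
    0 < Pr A [pred t | out t != None] /\
    1 - eps <= condPr A [pred t | out t == Some (f x)] [pred t | out t != None].

Definition PostR_cost (R : realType) (N : nat) (eps : R)
    (f : input N -> bool) (d : nat) : Prop :=
  exists A : distr R (dtree N),
    postselect_computes eps f A /\ distr_depth A = d.

Section PostR_exists.
Variables (R : realType) (N : nat) (f : input N -> bool).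

Definition upd (x : input N) (i : 'I_N) (b : bool) : input N :=
  [ffun j => if j == i then b else x j].

Fixpoint full_tree (s : seq 'I_N) (x : input N) : dtree N :=
  match s with
  | [::] => Leaf (Some (f x))
  | i :: s' =>
      Query i (full_tree s' (upd x i false)) (full_tree s' (upd x i true))
  end.

Lemma full_tree_eval (s : seq 'I_N) (x y : input N) :
  (forall j, j \notin s -> x j = y j) ->
  dtree_eval (full_tree s x) y = Some (f y).
Proof.
elim: s x => [|i s IH] x /= xy.
  by congr (Some (f _)); apply/ffunP => j; apply: xy.
have updP j : j \notin s -> upd x i (y i) j = y j.
  move=> js; rewrite ffunE; case: eqP => [->//|/eqP ji].
  by apply: xy; rewrite inE negb_or ji.
by case yi : (y i); apply: IH; rewrite -yi.
Qed.

Section Dirac.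
Variables (T : choiceType) (t0 : T).

Definition dirac_fun : {fsfun T -> R with 0} :=
  [fsfun t in [fset t0]%fset => 1 | 0].

Lemma dirac_funE t : dirac_fun t = (t == t0)%:R.
Proof. by rewrite /dirac_fun fsfunE inE; case: eqP. Qed.

Lemma finsupp_dirac : finsupp dirac_fun = [fset t0]%fset.
Proof.
apply/fsetP => t; rewrite mem_finsupp dirac_funE inE.
by case: (t == t0); rewrite ?oner_eq0 ?eqxx.
Qed.

Lemma dirac_ge0 t : 0 <= dirac_fun t.
Proof. by rewrite dirac_funE ler0n. Qed.

Lemma dirac_sum1 : \sum_(t <- finsupp dirac_fun) dirac_fun t = 1.
Proof. by rewrite finsupp_dirac big_seq_fset1 dirac_funE eqxx. Qed.

Definition dirac_distr : distr R T := Distr dirac_ge0 dirac_sum1.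

Lemma Pr_dirac (E : pred T) : E t0 -> Pr dirac_distr E = 1.
Proof.
move=> Et0; rewrite /Pr /= big_mkcond finsupp_dirac big_seq_fset1 Et0.
by rewrite dirac_funE eqxx.
Qed.
End Dirac.

Lemma PostR_cost_exists (eps : {nonneg R}) :
  exists d, `[< PostR_cost eps%:num f d >].
Proof.
set t := full_tree (enum 'I_N) [ffun=> false].
exists (distr_depth (dirac_distr t)); apply/asboolP.
exists (dirac_distr t); split=> // x /=.
have tx : dtree_eval t x = Some (f x).
  by apply: full_tree_eval => j; rewrite mem_enum.
rewrite /condPr !Pr_dirac /= ?tx ?eqxx //.
by rewrite divr1 ltr01; split=> //; rewrite gerBl.
Qed.

End PostR_exists.

(* The minimum exists because querying all the variables has error 0. *)
Definition PostR (R : realType) (N : nat) (eps : {nonneg R})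
    (f : input N -> bool) : nat :=
  ex_minn (PostR_cost_exists f eps).

(* Main.v *)
(* Let u = k+1 and v = N-k be the numbers of edges going down from level k+1
   and up from level k of the cube.  If t has depth at most d then, at every x,
   all but d of the coordinates can be flipped without changing t(x), so double
   counting the edges inside {x | t(x) = o} shows that the average P_o of
   Pr[A(x) = o] over a level satisfies
     (v-d)/v P_o(k) <= P_o(k+1) <= u/(u-d) P_o(k).
   When f_k <> f_(k+1), the ratio P_1/P_0 has to change by a factor at least 4
   between the two levels, which forces 2d >= min(u, v). *)
Require Import Defs.
From mathcomp Require Import all_boot all_order all_algebra.
From mathcomp Require Import all_fingroup finmap boolp zify lra.
From mathcomp Require Import reals interval_inference.
Local Open Scope ring_scope.
Import Order.TTheory GRing.Theory Num.Theory.

Definition flip {N : nat} (x : input N) (i : 'I_N) : input N :=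
  upd x i (~~ x i).

(** The parameter [b] lets one counting argument serve both directions between levels: [weight true]
    is the Hamming weight, [weight false] its complement in [N]. *)
Definition weight {N : nat} (b : bool) (x : input N) : nat :=
  #|[set i | x i == b]|.

Lemma flipE {N : nat} (x : input N) (i j : 'I_N) :
  flip x i j = (j == i) (+) x j.
Proof. by rewrite ffunE; case: eqP => [->|]. Qed.

Lemma flipK {N : nat} (i : 'I_N) : involutive (fun x : input N => flip x i).
Proof. by move=> x; apply/ffunP => j; rewrite !flipE addKb. Qed.

Lemma weight_flip {N : nat} (b : bool) (x : input N) (i : 'I_N) :
  x i = b -> weight b x = (weight b (flip x i)).+1.
Proof.
move=> xi; rewrite /weight (cardsD1 i) inE xi eqxx; congr _.+1.
apply: eq_card => j; rewrite !inE flipE; case: eqP => [->|_] //=.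
by rewrite xi; case: b xi.
Qed.

Lemma weightC {N : nat} (b : bool) (x : input N) :
  (weight b x + weight (~~ b) x = N)%N.
Proof.
rewrite -[RHS](card_ord N) -(cardsC [set i | x i == b]); congr addn.
by apply: eq_card => i; rewrite !inE; case: (x i) b => [] [].
Qed.

Lemma weight_le {N : nat} (b : bool) (x : input N) : (weight b x <= N)%N.
Proof. by rewrite -{2}(weightC b x) leq_addr. Qed.

Lemma weight_prefix {N k : nat} : (k <= N)%N ->
  weight true ([ffun i : 'I_N => (i < k)%N] : input N) = k.
Proof.
move=> le_kN; rewrite -[RHS]card_ord.
have widen_inj : injective (widen_ord le_kN).
  by move=> i j /(congr1 val) /= /val_inj.
rewrite -(card_imset _ widen_inj); apply: eq_card => i; rewrite inE ffunE eqb_id.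
apply/idP/imsetP => [lti|[j _ ->]]; last exact: (ltn_ord j).
by exists (Ordinal lti) => //; apply: val_inj.
Qed.

(** Inputs of equal weight agree in their numbers of ones and of zeros, so their bit tuples are
    rearrangements of each other. *)
Lemma symmetric_funE {N : nat} {f : input N -> bool} (x : input N) :
  symmetric_fun f -> f x = weight_value f (weight true x).
Proof.
move=> f_sym; set y : input N := [ffun i : 'I_N => (i < weight true x)%N].
have ctE (z : input N) b : count_mem b [tuple z i | i < N] = weight b z.
  rewrite /weight cardsE cardE /= count_map -size_filter.
  by rewrite enumT.
have wy : weight true y = weight true x by rewrite weight_prefix ?weight_le.
have wxy b : weight b x = weight b y.
  case: b; first by rewrite wy.
  by apply: (@addnI (weight true x)); rewrite (weightC true) -wy (weightC true).
have /tuple_permP[s sE] : perm_eq [tuple y i | i < N] [tuple x i | i < N].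
  by apply/allP => b _; rewrite /= !ctE wxy.
rewrite /weight_value -/y -(f_sym s); congr f; apply/ffunP => i.
have /(congr1 (fun u => tnth u i)) :
    [tuple y i | i < N] = [tuple tnth [tuple x j | j < N] (s i) | i < N].
  by apply: val_inj.
rewrite !tnth_mktuple => yxs; by rewrite [LHS]ffunE yxs.
Qed.

Lemma sensitivity_le_depth {N : nat} (t : dtree N) (x : input N) :
  (#|[set i | dtree_eval t (flip x i) != dtree_eval t x]| <= dtree_depth t)%N.
Proof.
elim: t => [o|j t0 IH0 t1 IH1] /=.
  by rewrite leqn0 cards_eq0; apply/eqP/setP => i; rewrite !inE eqxx.
set S := [set _ | _]; set t := if x j then t1 else t0.
(* Flipping a bit other than the root variable [j] keeps the branch that [x] takes, so the root adds
   at most one sensitive coordinate. *)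
have : S \subset j |: [set i | dtree_eval t (flip x i) != dtree_eval t x].
  apply/subsetP => i; rewrite /S /t !inE flipE (eq_sym j i).
  by case: (i == j); case: (x j).
move/subset_leq_card/leq_trans; apply.
rewrite cardsU1 (leq_trans (leq_add (leq_b1 _) (leqnn _))) // add1n ltnS.
by rewrite leq_max /t; case: (x j); rewrite ?IH0 ?IH1 ?orbT.
Qed.

Definition outcome_count {N : nat} (b : bool) (k : nat) (t : dtree N)
    (o : option bool) : nat :=
  #|[set x : input N | (weight b x == k) && (dtree_eval t x == o)]|.

Lemma outcome_count_step {N : nat} (b : bool) (k : nat) (t : dtree N)
    (o : option bool) :
  ((k.+1 - dtree_depth t) * outcome_count b k.+1 t o
     <= (N - k) * outcome_count b k t o)%N.
Proof.
set E := fun x => dtree_eval t x == o.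
(* Double count the edges [x -- flip x i] of the cube inside [E]. *)
have swap : (\sum_(x | (weight b x == k.+1) && E x)
                #|[set i | (x i == b) && E (flip x i)]| =
             \sum_(x | (weight b x == k) && E x)
                #|[set i | (x i != b) && E (flip x i)]|)%N.
  under eq_bigr do rewrite -sum1dep_card.
  under [RHS]eq_bigr do rewrite -sum1dep_card.
  rewrite (exchange_big_dep predT) //= [RHS](exchange_big_dep predT) //=.
  apply: eq_bigr => i _.
  (* For fixed [i], flipping exchanges the upper and lower endpoints of the edges in direction
     [i]. *)
  rewrite (reindex_inj (inv_inj (flipK i))) /=; apply: eq_bigl => x.
  rewrite flipK flipE eqxx /=.
  case: (altP (x i =P b)) => [xi|xi].
    by rewrite xi [~~ b == b](_ : _ = false) ?andbF //; case: (b).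
  have nxi : ~~ x i = b by case: (x i) b xi => [] [].
  rewrite (weight_flip b (flip x i) i) ?flipE ?eqxx // flipK eqSS nxi eqxx /=.
  by rewrite -!andbA; congr andb; rewrite andbC.
(* Seen from below, an input of level [k] has at most [N - k] such edges, one for each coordinate
   different from [b]. *)
apply: (@leq_trans (\sum_(x | (weight b x == k.+1) && E x)
                #|[set i | (x i == b) && E (flip x i)]|)%N); last first.
  rewrite swap mulnC /outcome_count -sum1dep_card big_distrl /=.
  apply: leq_sum => x /andP[/eqP wx _]; rewrite mul1n -wx.
  have <- : weight (~~ b) x = (N - weight b x)%N by have := weightC b x; lia.
  apply: subset_leq_card.
  by apply/subsetP => i; rewrite !inE => /andP[+ _]; case: (x i); case: (b).
(* Seen from above, the [k.+1] coordinates equal to [b] all give edges inside [E], except the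
   sensitive ones. *)
rewrite mulnC /outcome_count -sum1dep_card big_distrl /=.
apply: leq_sum => x /andP[/eqP wx /eqP Ex]; rewrite mul1n -wx leq_subLR.
apply: leq_trans (leq_add (sensitivity_le_depth t x) (leqnn _)).
apply: leq_trans (leq_card_setU _ _); apply: subset_leq_card.
apply/subsetP => i; rewrite !inE /E Ex => ->; exact: orNb.
Qed.

Section Average.
Variables (R : realType) (N : nat) (A : distr R (dtree N)).

(* Sums, not averages, over the inputs of weight k: hence the coefficients
   below are N - k and k.+1, without binomials. *)
Definition mass (k : nat) (o : option bool) : R :=
  \sum_(x : input N | weight true x == k) Pr A [pred t | dtree_eval t x == o].

Lemma massE (k : nat) (o : option bool) :
  mass k o = \sum_(t <- finsupp A) A t * (outcome_count true k t o)%:R.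
Proof.
rewrite /mass /Pr.
under eq_bigr do rewrite big_mkcond.
rewrite exchange_big; apply: eq_bigr => t _ /=.
rewrite -big_mkcondr /= sumr_const mulr_natr; congr (_ *+ _).
by apply: eq_card => x; rewrite !inE.
Qed.

(** Masses are linear in [A], so an inequality between counts passes from the trees of the support
    to their mixture. *)
Lemma mass_le (m n k l : nat) (o : option bool) :
  {in finsupp A, forall t,
    m * outcome_count true k t o <= n * outcome_count true l t o}%N ->
  m%:R * mass k o <= n%:R * mass l o.
Proof.
move=> le_mn; rewrite !massE !mulr_sumr big_seq [leRHS]big_seq.
apply: ler_sum => t /le_mn le_t; rewrite !(mulrCA _%:R) ler_wpM2l ?pmf_ge0 //.
by rewrite -!natrM ler_nat.
Qed.

Lemma depth_le_distr (t : dtree N) :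
  t \in finsupp A -> (dtree_depth t <= distr_depth A)%N.
Proof. by move=> tA; apply: leq_bigmax_seq. Qed.

Lemma mass_succ_le (k : nat) (o : option bool) :
  (k.+1 - distr_depth A)%:R * mass k.+1 o <= (N - k)%:R * mass k o.
Proof.
apply: mass_le => t /depth_le_distr tA.
apply: leq_trans (outcome_count_step true k t o).
by rewrite leq_mul2r leq_sub2l ?orbT.
Qed.

(** Counting zeros instead of ones reverses the order of the levels, so [outcome_count_step] also
    yields the upward bound [mass_le_succ]. *)
Lemma outcome_countC (k : nat) (t : dtree N) (o : option bool) :
  (k <= N)%N -> outcome_count true k t o = outcome_count false (N - k) t o.
Proof.
move=> le_kN; apply: eq_card => x; rewrite !inE; congr andb.
by have := weightC true x => /= wx; apply/eqP/eqP; lia.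
Qed.

Lemma mass_le_succ (k : nat) (o : option bool) : (k < N)%N ->
  (N - k - distr_depth A)%:R * mass k o <= k.+1%:R * mass k.+1 o.
Proof.
move=> lt_kN; apply: mass_le => t /depth_le_distr tA.
rewrite !outcome_countC ?(ltnW lt_kN) // -(subnSK lt_kN).
have := outcome_count_step false (N - k.+1) t o; rewrite subKn //.
by apply: leq_trans; rewrite leq_mul2r leq_sub2l ?orbT.
Qed.

(** Clearing the denominator of the conditional probability turns error 1/3 into a linear inequality
    at each input, which can be summed over a level. *)
Lemma postselect_mass {f : input N -> bool} {k : nat} :
  symmetric_fun f -> postselect_computes 3%:R^-1 f A -> (k <= N)%N ->
  let b := weight_value f k in
  0 < mass k (Some b) /\ 2%:R * mass k (Some (~~ b)) <= mass k (Some b).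
Proof.
move=> f_sym fA le_kN b.
have PrA x : weight true x = k ->
    0 < Pr A [pred t | dtree_eval t x == Some b] /\
    2%:R * Pr A [pred t | dtree_eval t x == Some (~~ b)]
       <= Pr A [pred t | dtree_eval t x == Some b].
  move=> wx; have [] := fA x; rewrite /condPr (symmetric_funE _ f_sym) wx -/b.
  set q := Pr A [pred t | dtree_eval t x != None] => q0.
  rewrite ler_pdivlMr //.
  have -> : Pr A [pred t | [pred t0 | dtree_eval t0 x == Some b] t
                & [pred t0 | dtree_eval t0 x != None] t]
          = Pr A [pred t | dtree_eval t x == Some b].
    by apply: eq_bigl => t /=; case: (dtree_eval t x) => [c|]; rewrite ?andbT.
  have qE : q = Pr A [pred t | dtree_eval t x == Some b] +
                Pr A [pred t | dtree_eval t x == Some (~~ b)].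
    rewrite /q /Pr (bigID [pred t | dtree_eval t x == Some b]) /=.
    by congr (_ + _); apply: eq_bigl => t;
      case: (dtree_eval t x) => [[]|]; case: (b).
  by move: q0; rewrite qE; split; lra.
have wk : weight true ([ffun i : 'I_N => (i < k)%N] : input N) = k.
  exact: weight_prefix.
split; last first.
  by rewrite mulr_sumr ler_sum // => x /eqP /PrA [].
rewrite /mass (bigD1 ([ffun i : 'I_N => (i < k)%N] : input N)) ?wk //=.
apply: ltr_wpDr; last by case: (PrA _ wk).
by apply: sumr_ge0 => x /andP[/eqP /PrA[/ltW]].
Qed.

Lemma depth_ge_jump (f : input N -> bool) (k : nat) :
  symmetric_fun f -> postselect_computes 3%:R^-1 f A -> (k < N)%N ->
  weight_value f k != weight_value f k.+1 ->
  (minn k.+1 (N - k) <= 2 * distr_depth A)%N.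
Proof.
move=> f_sym fA lt_kN jump; rewrite leqNgt leq_min; apply/negP => /andP[ltu ltv].
have [p0 pq] := postselect_mass f_sym fA (ltnW lt_kN).
have [] := postselect_mass f_sym fA lt_kN.
have -> : weight_value f k.+1 = ~~ weight_value f k.
  by move: jump; case: (weight_value f k); case: (weight_value f k.+1).
rewrite negbK; set b := weight_value f k in p0 pq *.
have := mass_le_succ k (Some b) lt_kN.
have := mass_succ_le k (Some (~~ b)).
(* By contradiction, the depth is less than half of [k.+1] and of [N - k], so subtracting it leaves
   more than half of each. *)
have : (k.+1%:R : R) < 2%:R * (k.+1 - distr_depth A)%:R.
  by rewrite -natrM ltr_nat; lia.
have : ((N - k)%:R : R) < 2%:R * (N - k - distr_depth A)%:R.
  by rewrite -natrM ltr_nat; lia.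
have : (0 : R) < (N - k)%:R by rewrite ltr0n subn_gt0.
have : (0 : R) < k.+1%:R by rewrite ltr0n.
move: p0 pq; move: (mass k (Some b)) (mass k (Some (~~ b)))
  (mass k.+1 (Some b)) (mass k.+1 (Some (~~ b))).
move: (k.+1%:R) (N - k)%:R (k.+1 - distr_depth A)%:R (N - k - distr_depth A)%:R.
(* Primes on [p], [q] mean level [k.+1], where [q'] is the mass of the correct label; primes on [u],
   [v] mean that the depth is subtracted. *)
move=> u v u' v' p q p' q' p0 pq u0 v0 vv uu quv puv q0 pq'.
(* 2 v' p <= 2 u p' <= u q' < 2 u' q' <= 2 v q <= v p < 2 v' p *)
have vp : v * p < 2%:R * v' * p by rewrite ltr_pM2r.
have uq : u * q' < 2%:R * u' * q' by rewrite ltr_pM2r.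
have vpq : v * (2%:R * q) <= v * p by rewrite ler_pM2l.
have upq : u * (2%:R * p') <= u * q' by rewrite ler_pM2l.
lra.
Qed.
End Average.

Theorem theorem4 (R : realType) (N : nat) (f : {ffun 'I_N -> bool} -> bool)
    (f_sym : symmetric_fun f) (f_nonconst : nonconstant f) :
  8%:R^-1 * (N%:R - (Gamma f)%:R) <= (PostR (3%:R^-1 : R)%:nng f)%:R :> R.
Proof.
rewrite /PostR; case: ex_minnP => d /asboolP[A [fA dA]] _.
suff : (N <= 8 * d + Gamma f)%N.
  by rewrite -(ler_nat R) natrD natrM => le_N; lra.
(* The default [N] satisfies the bound trivially. At a jump, [minn k.+1 (N - k)] is half of
   [N + 1 - |2k - N + 1|], since its two arguments have sum [N + 1] and difference [2k - N + 1]. *)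
apply: (big_ind (fun g => N <= 8 * d + g)%N) => [|g h|k jump].
- exact: leq_addl.
- by rewrite /minn; case: ifP.
- have := depth_ge_jump R N A f k f_sym fA (ltn_ord k) jump.
  by rewrite dA; have := ltn_ord k; lia.
Qed.
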